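(* Let $As_3^1$ be the three-dimensional complex associative algebra with zero multiplication. Any three-dimensional complex anti-dendriform algebra associated to the algebra $As_3^1$ is isomorphic to one of the following pairwise non-isomorphic algebras (with basis $\{e_1,e_2,e_3\}$, omitted products being zero): $AD_3^3:$ trivial, that is, all products are zero; $AD_3^4:\ e_1\vartriangleright e_2=e_3,\ e_2\vartriangleright e_1=-e_3,\ e_1\vartriangleleft e_2=-e_3,\ e_2\vartriangleleft e_1=e_3;$ $AD_3^5:\ e_1\vartriangleright e_1=e_3,\ e_1\vartriangleleft e_1=-e_3;$ $AD_3^6:\ e_1\vartriangleright e_2=e_3,\ e_1\vartriangleleft e_2=-e_3;$ $AD_3^7(\lambda):\ e_1\vartriangleright e_1=e_3,\ e_1\vartriangleright e_2=\lambda e_3,\ e_2\vartriangleright e_2=e_3,\ e_1\vartriangleleft e_1=-e_3,\ e_1\vartriangleleft e_2=-\lambda e_3,\ e_2\vartriangleleft e_2=-e_3;$ where $\lambda\in\mathbb{C}$.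
   Context: An anti-dendriform algebra is a vector space $A$ with two bilinear operations $\vartriangleright,\vartriangleleft: A\otimes A\to A$ such that, writing $x\cdot y=x\vartriangleright y+x\vartriangleleft y$, for all $x,y,z\in A$: $x\vartriangleright(y\vartriangleright z)=-(x\cdot y)\vartriangleright z=-x\vartriangleleft(y\cdot z)=(x\vartriangleleft y)\vartriangleleft z$ and $(x\vartriangleright y)\vartriangleleft z=x\vartriangleright(y\vartriangleleft z)$. Then $(A,\cdot)$ is an associative algebra, called the associated associative algebra of $(A,\vartriangleright,\vartriangleleft)$. An anti-dendriform algebra is associated to an associative algebra $B$ if its associated associative algebra is (isomorphic to) $B$. Isomorphisms of anti-dendriform algebras are linear bijections preserving both operations $\vartriangleright$ and $\vartriangleleft$.
   Formalization: ''Pairwise non-isomorphic'' fails as stated: AD_3^7(λ) and AD_3^7(-λ) are isomorphic via e_2 -> -e_2; the theorem proved says two listed algebras are isomorphic exactly when they are the same or are AD_3^7(λ) and AD_3^7(-λ). *)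

(* Defs.v *)
From HB Require Import structures.
From mathcomp Require Import all_boot all_order all_algebra.
From mathcomp Require Import reals complex.

Set Implicit Arguments.
Unset Strict Implicit.
Unset Printing Implicit Defensive.

Import GRing.Theory.
Local Open Scope ring_scope.

(* [algType] would require a unit, hence a separate structure. *)
Record assocAlgebra (K : fieldType) (B : lmodType K) := AssocAlgebra {
  amul : {bilinear B -> B -> B};
  amulA : associative amul
}.

Record dialgebra (K : fieldType) (A : lmodType K) := Dialgebra {
  rprod : {bilinear A -> A -> A};
  lprod : {bilinear A -> A -> A}
}.

Definition dot (K : fieldType) (A : lmodType K) (D : dialgebra A) (x y : A) : A :=
  rprod D x y + lprod D x y.

Definition antidendriform (K : fieldType) (A : lmodType K) (D : dialgebra A) : Prop :=
  forall x y z : A,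
    [/\ rprod D x (rprod D y z) = - rprod D (dot D x y) z,
        - rprod D (dot D x y) z = - lprod D x (dot D y z),
        - lprod D x (dot D y z) = lprod D (lprod D x y) z
      & lprod D (rprod D x y) z = rprod D x (lprod D y z)].

Definition associated_to (K : fieldType) (A B : lmodType K)
    (D : dialgebra A) (M : assocAlgebra B) : Prop :=
  exists2 f : {linear A -> B}, bijective f &
    forall x y, f (dot D x y) = amul M (f x) (f y).

Definition dialgebra_iso (K : fieldType) (A B : lmodType K)
    (D : dialgebra A) (E : dialgebra B) : Prop :=
  exists2 f : {linear A -> B}, bijective f &
    (forall x y, f (rprod D x y) = rprod E (f x) (f y)) /\
    (forall x y, f (lprod D x y) = lprod E (f x) (f y)).

Section StructureConstants.
Variables (K : fieldType) (c : nat -> nat -> 'rV[K]_3).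

(* [c] is indexed from 1: [c i j] is the product of e_i and e_j. *)
Definition sc_mul (x y : 'rV[K]_3) : 'rV[K]_3 :=
  \sum_(i < 3) \sum_(j < 3) (x 0 i * y 0 j) *: c i.+1 j.+1.

Lemma sc_mul_bilinear : bilinear_for *:%R *:%R sc_mul.
Proof.
split=> [y a x x'|x a y y']; rewrite /sc_mul /= scaler_sumr -big_split /=;
  apply: eq_bigr => i _; rewrite scaler_sumr -big_split /=;
  apply: eq_bigr => j _; rewrite !mxE scalerA -scalerDl.
- by rewrite mulrDl mulrA.
- by rewrite mulrDr mulrCA.
Qed.

HB.instance Definition _ :=
  bilinear_isBilinear.Build K 'rV[K]_3 'rV[K]_3 'rV[K]_3 *:%R *:%R
    sc_mul sc_mul_bilinear.

End StructureConstants.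

Definition e (K : fieldType) (k : nat) : 'rV[K]_3 := \row_(j < 3) (j.+1 == k)%:R.

Lemma sc_mul0 (K : fieldType) (x y : 'rV[K]_3) : sc_mul (fun _ _ => 0) x y = 0.
Proof. by rewrite /sc_mul big1 // => i _; rewrite big1 // => j _; rewrite scaler0. Qed.

Lemma As31_mulA (K : fieldType) : associative (@sc_mul K (fun _ _ => 0)).
Proof. by move=> x y z; rewrite !sc_mul0. Qed.

Definition As31 (K : fieldType) : assocAlgebra 'rV[K]_3 :=
  @AssocAlgebra K 'rV[K]_3 (@sc_mul K (fun _ _ => 0)) (@As31_mulA K).

Inductive AD_label (K : fieldType) : Type :=
  | AD33 | AD34 | AD35 | AD36 | AD37 of K.
Arguments AD33 {K}.
Arguments AD34 {K}.
Arguments AD35 {K}.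
Arguments AD36 {K}.

Definition AD_r (K : fieldType) (s : AD_label K) (i j : nat) : 'rV[K]_3 :=
  match s, i, j with
  | AD34, 1%N, 2%N => e K 3
  | AD34, 2%N, 1%N => - e K 3
  | AD35, 1%N, 1%N => e K 3
  | AD36, 1%N, 2%N => e K 3
  | AD37 _, 1%N, 1%N => e K 3
  | AD37 lambda, 1%N, 2%N => lambda *: e K 3
  | AD37 _, 2%N, 2%N => e K 3
  | _, _, _ => 0
  end.

Definition AD_l (K : fieldType) (s : AD_label K) (i j : nat) : 'rV[K]_3 :=
  match s, i, j with
  | AD34, 1%N, 2%N => - e K 3
  | AD34, 2%N, 1%N => e K 3
  | AD35, 1%N, 1%N => - e K 3
  | AD36, 1%N, 2%N => - e K 3
  | AD37 _, 1%N, 1%N => - e K 3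
  | AD37 lambda, 1%N, 2%N => - (lambda *: e K 3)
  | AD37 _, 2%N, 2%N => - e K 3
  | _, _, _ => 0
  end.

Definition AD (K : fieldType) (s : AD_label K) : dialgebra 'rV[K]_3 :=
  Dialgebra (sc_mul (AD_r s)) (sc_mul (AD_l s)).

(* The change of basis e_2 |-> - e_2 carries AD37 lambda to AD37 (- lambda), so
   distinct parameters can give isomorphic algebras; this is the only such
   coincidence in the list. *)
Definition same_class (K : fieldType) (s t : AD_label K) : Prop :=
  s = t \/ exists lambda : K, s = AD37 lambda /\ t = AD37 (- lambda).

(* Main.v *)
Require Import Defs.
From HB Require Import structures.
From mathcomp Require Import all_boot all_order all_algebra.
From mathcomp Require Import boolp reals complex.
From mathcomp Require Import ring.

Set Implicit Arguments.
Unset Strict Implicit.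
Unset Printing Implicit Defensive.

Import GRing.Theory.
Local Open Scope ring_scope.

(** An algebra associated to the zero product satisfies x ◃ y = - x ▹ y, and
    the anti-dendriform identities then say that every product of three
    elements vanishes ([rprod_rprodr], [rprod_rprodl]): all products lie in the
    two-sided annihilator.  In dimension three this makes ▹ a bilinear form
    with values in a line spanned by an annihilating vector, and the listed
    algebras are the normal forms of such a form up to congruence and scaling.

    Existence.  If some square w = u ▹ u is nonzero, all products are multiples
    of w ([rprod_square_span]), since a product w' outside the line of w would
    give a basis u, w', w in which only u ▹ u survives.  Completing u, w by a
    vector v, corrected by a multiple of u so that v ▹ u = 0, leaves two
    parameters, u ▹ v = t w and v ▹ v = d w.  For d != 0, rescaling v by a
    square root of 1/d, which exists over the complex numbers, gives AD37; for
    d = 0 = t this is AD35; for d = 0 and t != 0, subtracting v/t from u kills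
    its square and gives AD36
    ([AD_iso_of_square]).  If all squares vanish, ▹ is zero or, for any x and y
    with x ▹ y != 0, the basis x, y, x ▹ y exhibits AD34
    ([AD_iso_of_alternating]).

    Uniqueness.  An isomorphism between two listed algebras that are not
    trivial maps e_3 to mu e_3, and its 2 x 2 block P on the classes of e_1, e_2
    satisfies P B_t P^T = mu B_s, where B_s and B_t are the matrices of ▹.
    Congruence by P multiplies the determinant of a 2 x 2 matrix B by (det P)^2
    and its skew part B_12 - B_21 by det P ([AD_iso_gram]).
    These two numbers, with the vanishing of all squares, separate the
    nontrivial algebras, and for AD37 they leave exactly the ambiguity
    lambda = +- lambda', realised by changing the sign of e_2
    ([AD37_iso_opp]). *)

Lemma sum_ord3 (V : nmodType) (F : 'I_3 -> V) :
  \sum_i F i = F 0 + F 1 + F 2.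
Proof.
by rewrite !big_ord_recr big_ord0 /= add0r; congr (F _ + F _ + F _); apply: val_inj.
Qed.

Section AntiDendriform.
Variable K : fieldType.

(** * The listed algebras as bilinear forms *)

Section ListedAlgebras.
Implicit Types s t : AD_label K.

(** The matrix of ▹ on [e K 1] and [e K 2], indexed from 1 like the structure
    constants, once the line of [e K 3] is identified with [K]. *)
Definition gram s (i j : nat) : K :=
  match s, i, j with
  | AD34, 1%N, 2%N => 1
  | AD34, 2%N, 1%N => - 1
  | AD35, 1%N, 1%N => 1
  | AD36, 1%N, 2%N => 1
  | AD37 _, 1%N, 1%N => 1
  | AD37 lambda, 1%N, 2%N => lambda
  | AD37 _, 2%N, 2%N => 1
  | _, _, _ => 0
  end.

Lemma AD_rE s i j : AD_r s i j = gram s i j *: e K 3.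
Proof.
by case: s => [||||a]; case: i => [|[|[|i]]]; case: j => [|[|[|j]]];
  rewrite /= ?scale0r ?scaleNr ?scale1r.
Qed.

Lemma AD_lE s i j : AD_l s i j = - AD_r s i j.
Proof.
by case: s => [||||a]; case: i => [|[|[|i]]]; case: j => [|[|[|j]]];
  rewrite /= ?oppr0 ?opprK.
Qed.

Definition ADform s (x y : 'rV[K]_3) : K :=
  x 0 0 * y 0 0 * gram s 1 1 + x 0 0 * y 0 1 * gram s 1 2
  + x 0 1 * y 0 0 * gram s 2 1 + x 0 1 * y 0 1 * gram s 2 2.

Lemma AD_rprodE s x y : rprod (AD s) x y = ADform s x y *: e K 3.
Proof.
rewrite /= /sc_mul !sum_ord3 !AD_rE /= !scalerA -!scalerDl; congr (_ *: _).
by rewrite /ADform; case: s => [||||a] /=; ring.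
Qed.

Lemma AD_lprodE s x y : lprod (AD s) x y = - rprod (AD s) x y.
Proof.
rewrite /= /sc_mul -sumrN; apply: eq_bigr => i _.
by rewrite -sumrN; apply: eq_bigr => j _; rewrite AD_lE scalerN.
Qed.

Lemma AD_dot0 s x y : dot (AD s) x y = 0.
Proof. by rewrite /dot AD_lprodE subrr. Qed.

Lemma ADform_e3l s a x : ADform s (a *: e K 3) x = 0.
Proof. by rewrite /ADform !mxE /=; ring. Qed.

Lemma ADform_e3r s a x : ADform s x (a *: e K 3) = 0.
Proof. by rewrite /ADform !mxE /=; ring. Qed.

Lemma AD_antidendriform s : antidendriform (AD s).
Proof.
move=> x y z; rewrite !AD_dot0 linear0l linear0r !AD_lprodE !AD_rprodE.
by rewrite -!scaleNr !ADform_e3l !ADform_e3r; split; rewrite ?scale0r ?oppr0 ?scale0r.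
Qed.

Lemma AD_associated_As31 s : associated_to (AD s) (As31 K).
Proof.
by exists idfun => [|x y]; [exists id | rewrite AD_dot0 /= sc_mul0].
Qed.

End ListedAlgebras.

(** * Nilpotency of algebras associated to the zero product *)

Section ZeroDot.
Variables (A : lmodType K) (D : dialgebra A).
Hypothesis dot0 : forall x y, dot D x y = 0.

Lemma lprod_dot0 x y : lprod D x y = - rprod D x y.
Proof. by apply/eqP; rewrite -addr_eq0 addrC; apply/eqP/dot0. Qed.

Hypothesis adD : antidendriform D.

(** The first identity equates this product with - (x . y) ▹ z, where the
    associated product x . y is zero. *)
Lemma rprod_rprodr x y z : rprod D x (rprod D y z) = 0.
Proof. by case: (adD x y z) => -> _ _ _; rewrite dot0 linear0l oppr0. Qed.

(** Since ◃ is - ▹, the mixed identity (x ▹ y) ◃ z = x ▹ (y ◃ z) makes ▹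
    associative, which reduces this to [rprod_rprodr]. *)
Lemma rprod_rprodl x y z : rprod D (rprod D x y) z = 0.
Proof.
case: (adD x y z) => _ _ _; rewrite !lprod_dot0 linearNr rprod_rprodr oppr0.
by move/eqP; rewrite oppr_eq0 => /eqP.
Qed.

End ZeroDot.

Lemma associated_As31_dot0 (A : lmodType K) (D : dialgebra A) :
  associated_to D (As31 K) -> forall x y, dot D x y = 0.
Proof.
by case=> f /bij_inj f_inj fM x y; apply: f_inj; rewrite fM /= sc_mul0 linear0.
Qed.

(** * Normal forms through adapted bases *)

Section AdaptedBasis.
Variables (A : vectType K) (D : dialgebra A).
Hypothesis dimA : \dim {:A} = 3%N.

Section Coordinates.
Variable X : 3.-tuple A.

Definition coords (x : A) : 'rV[K]_3 := \row_i coord X i x.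

Lemma coords_linear : linear coords.
Proof. by move=> a x y; apply/rowP => i; rewrite !mxE linearP. Qed.

HB.instance Definition _ := GRing.isSemilinear.Build K A 'rV[K]_3 _ coords
  (GRing.semilinear_linear coords_linear).

Hypothesis Xbasis : basis_of fullv X.

Lemma coordsK : cancel coords (fun r : 'rV[K]_3 => \sum_i r 0 i *: X`_i).
Proof.
move=> x; rewrite [RHS](coord_basis Xbasis) ?memvf //.
by apply: eq_bigr => i _; rewrite mxE.
Qed.

Lemma coords_sumK : cancel (fun r : 'rV[K]_3 => \sum_i r 0 i *: X`_i) coords.
Proof.
by move=> r; apply/rowP => i; rewrite mxE coord_sum_free ?(basis_free Xbasis).
Qed.

Lemma coords_sc_mul (m : {bilinear A -> A -> A}) c :
  (forall i j : 'I_3, coords (m X`_i X`_j) = c i.+1 j.+1) ->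
  forall x y, coords (m x y) = sc_mul c (coords x) (coords y).
Proof.
move=> mX x y; rewrite -{1}(coordsK x) -{1}(coordsK y).
rewrite linear_sumlz linear_sum; apply: eq_bigr => i _.
rewrite linear_sumr linear_sum; apply: eq_bigr => j _.
by rewrite linearZl_LR linearZr_LR !linearZ /= scalerA mX.
Qed.

End Coordinates.

(** This is how every isomorphism onto a listed algebra is produced below: only
    the four products of [u] and [v] carry information, because [w] annihilates
    and ◃ is determined by ▹. *)
Lemma AD_iso_of_basis s (u v w : A) :
    (forall x y, dot D x y = 0) -> free [:: u; v; w] ->
    (forall x, rprod D x w = 0) -> (forall x, rprod D w x = 0) ->
    rprod D u u = gram s 1 1 *: w -> rprod D u v = gram s 1 2 *: w ->
    rprod D v u = gram s 2 1 *: w -> rprod D v v = gram s 2 2 *: w ->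
  dialgebra_iso D (AD s).
Proof.
move=> dot0 Xfree xw wx uu uv vu vv; pose X := [tuple u; v; w].
have Xbasis : basis_of fullv X by rewrite basisEfree Xfree subvf dimA.
have Xw : coords X w = e K 3.
  by apply/rowP => j; rewrite !mxE (coord_free 2) ?(basis_free Xbasis) // eq_sym.
have rX : forall x y, coords X (rprod D x y) = rprod (AD s) (coords X x) (coords X y).
  apply: coords_sc_mul => // i j; rewrite AD_rE -Xw -linearZ; congr (coords X _).
  by case: i j => [[|[|[|?]]] ?] [[|[|[|?]]] ?] //=; rewrite ?xw ?wx;
    case: (s) => [||||?]; rewrite /= scale0r.
exists (coords X).
  exists (fun r : 'rV[K]_3 => \sum_i r 0 i *: X`_i); first exact: coordsK.
  exact: coords_sumK.
split=> // x y.
by rewrite lprod_dot0 // AD_lprodE linearN; congr (- _); apply: rX.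
Qed.

Lemma free3P (u v w : A) :
  reflect (forall a b c : K, a *: u + b *: v + c *: w = 0 -> [/\ a = 0, b = 0 & c = 0])
          (free [:: u; v; w]).
Proof.
apply: (iffP (freeP (X := [tuple u; v; w]))) => [frX a b c abc0 | frX k].
  have /frX k0 : \sum_(i < 3) [:: a; b; c]`_i *: [tuple u; v; w]`_i = 0.
    by rewrite sum_ord3.
  by split; [apply: (k0 0) | apply: (k0 1) | apply: (k0 2)].
rewrite sum_ord3 => /frX[k0 k1 k2] i.
case: i => [[|[|[|?]]] ?] //=; [rewrite -k0|rewrite -k1|rewrite -k2];
  congr k; exact: val_inj.
Qed.

Lemma free3_decomp (u v w : A) : free [:: u; v; w] ->
  forall x, exists a b c : K, x = a *: u + b *: v + c *: w.
Proof.
move=> frX x; pose X := [tuple u; v; w].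
have Xbasis : basis_of fullv X by rewrite basisEfree frX subvf dimA.
exists (coords X x 0 0), (coords X x 0 1), (coords X x 0 2).
by rewrite -{1}(coordsK Xbasis x) sum_ord3.
Qed.

Hypotheses (dot0 : forall x y, dot D x y = 0) (adD : antidendriform D).

Let lin := (linearDl, linearDr, linearNl, linearNr, linearZl_LR, linearZr_LR).
Let nil3 := (rprod_rprodl dot0 adD, rprod_rprodr dot0 adD).

(** If [rprod D x y] were not on the line of the square w of [u], the vectors
    [u], [rprod D x y], w would be free, hence a basis of the space; the last
    two annihilate, so every product, [rprod D x y] included, would be a
    multiple of w. *)
Lemma rprod_square_span u x y :
  rprod D u u != 0 -> exists k, rprod D x y = k *: rprod D u u.
Proof.
move=> uu_neq0; apply/vlineP; apply: contraT => xy_notin.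
have frX : free [:: u; rprod D x y; rprod D u u].
  apply/free3P => a b c abc0.
  have a0 : a = 0.
    have /eqP := congr1 (rprod D u) abc0.
    rewrite !lin !nil3 !scaler0 !addr0 linear0r scaler_eq0 (negPf uu_neq0) orbF.
    by move/eqP.
  move: abc0; rewrite a0 scale0r add0r.
  have [-> | b_neq0 /eqP] := eqVneq b 0.
    rewrite scale0r add0r => /eqP; rewrite scaler_eq0 (negPf uu_neq0) orbF.
    by move/eqP.
  rewrite addr_eq0 => /eqP bw; case/negP: xy_notin.
  by rewrite -(scalerK b_neq0 (rprod D x y)) bw memvZ // memvN memvZ // memv_line.
have [a [b [c xE]]] := free3_decomp frX x.
have [a' [b' [c' yE]]] := free3_decomp frX y.
case/negP: xy_notin; apply/vlineP; exists (a * a').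
transitivity (rprod D (a *: u + b *: rprod D x y + c *: rprod D u u)
                      (a' *: u + b' *: rprod D x y + c' *: rprod D u u)).
  by rewrite -xE -yE.
by rewrite !lin !nil3 !scaler0 !addr0 scalerA.
Qed.

(** With w the square of [u], the corrected basis has gram matrix
    [[1, t], [0, d]], and the three cases d != 0, d = t = 0, d = 0 != t are
    AD37, AD35 and AD36. *)
Lemma AD_iso_of_square u :
    (forall x : K, exists y, y ^+ 2 = x) -> rprod D u u != 0 ->
  exists s, dialgebra_iso D (AD s).
Proof.
move=> sqrtK uu_neq0; set w := rprod D u u.
have xw x : rprod D x w = 0 by rewrite nil3.
have wx x : rprod D w x = 0 by rewrite nil3.
have fr_uw : free [:: u; w].
  rewrite free_cons seq1_free uu_neq0 andbT span_seq1.
  apply/negP => /vlineP[k uE]; case/eqP: uu_neq0.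
  by rewrite {1}uE linearZl_LR wx scaler0.
have [v0 _ v0_notin] : exists2 v0, v0 \in {:A}%VS & v0 \notin <<[:: u; w]>>%VS.
  apply/subvPn/negP => /dimvS; rewrite dimA leqNgt => /negP; apply.
  by rewrite ltnS dim_span.
have [c v0u] := rprod_square_span v0 u uu_neq0; rewrite -/w in v0u.
(* This correction achieves [v ▹ u = 0]. *)
pose v := v0 - c *: u.
have vu : rprod D v u = 0 by rewrite !lin v0u subrr.
have fr k : k != 0 -> free [:: u; k *: v; w].
  move=> k_neq0; rewrite (perm_free (Y := [:: k *: v; u; w])) ?(perm_catCA [:: u] [:: k *: v]) //.
  rewrite free_cons fr_uw andbT; apply: contra v0_notin => kv.
  rewrite -(subrK (c *: u) v0) -/v rpredD //.
    by rewrite -(scalerK k_neq0 v) rpredZ.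
  by rewrite rpredZ // memv_span // mem_head.
clearbody v.
have fr1 : free [:: u; v; w] by rewrite -[v]scale1r fr // oner_neq0.
have [t uv] := rprod_square_span u v uu_neq0; rewrite -/w in uv.
have [d vv] := rprod_square_span v v uu_neq0; rewrite -/w in vv.
have [d0 | d_neq0] := eqVneq d 0; last first.
  (* Scaling [v] by [r] turns [v ▹ v = d w] into [w], and [t] into [r * t]. *)
  have [r r2] := sqrtK d^-1.
  have r_neq0 : r != 0.
    by apply: contra_neq d_neq0 => r0; rewrite -[d]invrK -r2 r0 expr0n invr0.
  exists (AD37 (r * t)); apply: (AD_iso_of_basis dot0 (fr r r_neq0)) => //=.
  - by rewrite scale1r.
  - by rewrite lin uv scalerA.
  - by rewrite lin vu scaler0 scale0r.
  - by rewrite !lin vv !scalerA -expr2 r2 mulVf.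
rewrite d0 scale0r in vv.
have [t0 | t_neq0] := eqVneq t 0.
  rewrite t0 scale0r in uv.
  by exists AD35; apply: (AD_iso_of_basis dot0 fr1);
    rewrite /= ?scale0r ?scale1r.
(* The vector [u - v/t] is chosen for its square [w - t^-1 * t w = 0], as
   [v ▹ u] and [v ▹ v] vanish. *)
have fr2 : free [:: u - t^-1 *: v; v; t *: w].
  apply/free3P => a b k abk0.
  have [a0 b0 k0] : [/\ a = 0, b - a / t = 0 & k * t = 0].
    apply/(free3P _ _ _ fr1); rewrite -[RHS]abk0.
    rewrite scalerBl scalerBr !scalerA; congr (_ + _).
    by rewrite addrA addrAC.
  move: b0 k0 => /eqP; rewrite a0 mul0r subr0 => /eqP -> /eqP.
  by rewrite mulf_eq0 (negPf t_neq0) orbF => /eqP ->.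
exists AD36; apply: (AD_iso_of_basis dot0 fr2) => [x | x | | | |] /=.
- by rewrite lin xw scaler0.
- by rewrite lin wx scaler0.
- by rewrite !lin -/w uv vu vv !scaler0 !oppr0 !addr0 scalerA mulVf // scale1r subrr scale0r.
- by rewrite !lin uv vv scaler0 subr0 scale1r.
- by rewrite !lin vu vv scaler0 subr0 scale0r.
- by rewrite vv scale0r.
Qed.

(** Vanishing squares make ▹ skew-symmetric.  When w = x ▹ y is nonzero, x, y, w
    are free: multiplying a relation by [y] on the right isolates the
    coefficient of [x], and by [x] on the left that of [y]. *)
Lemma AD_iso_of_alternating :
  (forall u, rprod D u u = 0) -> exists s, dialgebra_iso D (AD s).
Proof.
move=> alt.
have skew x y : rprod D y x = - rprod D x y.
  have /eqP := alt (x + y); rewrite !lin !alt add0r addr0 addr_eq0 => /eqP ->.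
  by rewrite opprK.
have [[x [y xy_neq0]] | D0] := EM (exists x y, rprod D x y != 0).
  pose w := rprod D x y.
  exists AD34; apply: (@AD_iso_of_basis _ x y w) => //=.
  - apply/free3P => a b c abc0.
    have a0 : a = 0.
      have /eqP := congr1 (fun z => rprod D z y) abc0.
      rewrite !lin alt nil3 !scaler0 !addr0 linear0l scaler_eq0 (negPf xy_neq0).
      by rewrite orbF => /eqP.
    have b0 : b = 0.
      have /eqP := congr1 (rprod D x) abc0.
      rewrite !lin alt nil3 !scaler0 addr0 add0r linear0r scaler_eq0.
      by rewrite (negPf xy_neq0) orbF => /eqP.
    move: abc0; rewrite a0 b0 !scale0r !add0r => /eqP.
    by rewrite scaler_eq0 (negPf xy_neq0) orbF => /eqP.
  - by move=> z; rewrite nil3.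
  - by move=> z; rewrite nil3.
  - by rewrite alt scale0r.
  - by rewrite scale1r.
  - by rewrite skew scaleN1r.
  - by rewrite alt scale0r.
have m0 x y : rprod D x y = 0.
  by apply: contrapT => /eqP xy; apply: D0; exists x, y.
have [u [v [w frX]]] : exists u v w : A, free [:: u; v; w].
  have := vbasisP {:A}; case: (vbasis _) => X' /= /eqP; rewrite dimA.
  by case: X' => [|u [|v [|w []]]] // _ /basis_free frX; exists u, v, w.
by exists AD33; apply: (AD_iso_of_basis dot0 frX);
  rewrite //= ?m0 ?scale0r.
Qed.

End AdaptedBasis.

Lemma antidendriform_classification (A : vectType K) (D : dialgebra A) :
    (forall x : K, exists y, y ^+ 2 = x) -> \dim {:A} = 3%N ->
    antidendriform D -> associated_to D (As31 K) ->
  exists s : AD_label K, dialgebra_iso D (AD s).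
Proof.
move=> sqrtK dimA adD /associated_As31_dot0 dot0.
have [[u uu] | alt] := EM (exists u, rprod D u u != 0).
  exact: AD_iso_of_square uu.
apply: AD_iso_of_alternating => // u.
by apply: contrapT => /eqP uu; apply: alt; exists u.
Qed.

(** * Isomorphisms between the listed algebras *)

Section Isomorphisms.
Implicit Types s t : AD_label K.

Lemma ADform_e s i j : (0 < i < 3)%N -> (0 < j < 3)%N ->
  ADform s (e K i) (e K j) = gram s i j.
Proof.
by case: i => [|[|[|?]]] // _; case: j => [|[|[|?]]] // _;
  rewrite /ADform !mxE /=; ring.
Qed.

Lemma row3E (x : 'rV[K]_3) :
  x = x 0 0 *: e K 1 + x 0 1 *: e K 2 + x 0 2 *: e K 3.
Proof.
apply/rowP => -[[|[|[|?]]] ?] //=; rewrite !mxE /= ?(mulr0, mulr1, addr0, add0r);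
  congr (x _ _); exact: val_inj.
Qed.

Lemma e3_neq0 : e K 3 != 0.
Proof. by apply/eqP => /rowP/(_ 2)/eqP; rewrite !mxE /= oner_eq0. Qed.

Lemma ADform_neq0 s : s <> AD33 -> exists x y, ADform s x y = 1.
Proof.
case: s => [||||a] // _; [exists (e K 1), (e K 2)|exists (e K 1), (e K 1)
  |exists (e K 1), (e K 2)|exists (e K 1), (e K 1)]; exact: ADform_e.
Qed.

(** In AD36 both [e K 1] and [e K 2] have zero square, and only their sum shows
    that ▹ is not alternating. *)
Lemma ADform_square s :
  (exists x, ADform s x x != 0) <-> (s <> AD33 /\ s <> AD34).
Proof.
split=> [[x xx] | [s33 s34]].
  by split=> s_eq; case/eqP: xx; rewrite s_eq /ADform /=; ring.
case: s s33 s34 => [||||a] // _ _; try by exists (e K 1); rewrite ADform_e ?oner_neq0.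
exists (e K 1 + e K 2); rewrite /ADform !mxE /=.
by rewrite !(addr0, add0r, mulr0, mulr1) oner_neq0.
Qed.

Definition gdet s := gram s 1 1 * gram s 2 2 - gram s 1 2 * gram s 2 1.

(** The skew part of a 2 x 2 matrix has a single entry, a Pfaffian; congruence by
    P multiplies it by det P, as it multiplies the determinant by (det P)^2. *)
Definition gskew s := gram s 1 2 - gram s 2 1.

(** A nontrivial [s] has two elements with product [e K 3], so the isomorphism
    sends [e K 3] to a product of [AD t], which lies on the line of [e K 3]. *)
Lemma AD_iso_form s t : dialgebra_iso (AD s) (AD t) -> s <> AD33 ->
  exists (f : {linear 'rV[K]_3 -> 'rV[K]_3}) (mu : K),
    [/\ bijective f, mu != 0, f (e K 3) = mu *: e K 3 &
        forall x y, ADform t (f x) (f y) = mu * ADform s x y].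
Proof.
case=> f f_bij [fr _] s_neq0.
have fB x y : ADform s x y *: f (e K 3) = ADform t (f x) (f y) *: e K 3.
  by rewrite -linearZ -!AD_rprodE fr.
have [x [y xy1]] := ADform_neq0 s_neq0.
pose mu := ADform t (f x) (f y).
have fe3 : f (e K 3) = mu *: e K 3 by rewrite -fB xy1 scale1r.
exists f, mu; split=> // [|x' y'].
  apply: contra_neq e3_neq0 => mu0; apply: (bij_inj f_bij).
  by rewrite fe3 mu0 scale0r linear0.
have /eqP := fB x' y'; rewrite fe3 scalerA -subr_eq0 -scalerBl scaler_eq0.
by rewrite (negPf e3_neq0) orbF subr_eq0 mulrC => /eqP.
Qed.

(** Here [rho] is the determinant of the 2 x 2 block P of the isomorphism; the two
    equations are det and skew part of P B_t P^T = mu B_s. *)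
Lemma AD_iso_gram s t : dialgebra_iso (AD s) (AD t) -> s <> AD33 ->
  exists mu rho : K, [/\ mu != 0, rho != 0,
    mu ^+ 2 * gdet s = rho ^+ 2 * gdet t & mu * gskew s = rho * gskew t].
Proof.
move=> st s_neq0; have [f [mu [f_bij mu_neq0 fe3 fB]]] := AD_iso_form st s_neq0.
pose p := f (e K 1); pose q := f (e K 2).
exists mu, (p 0 0 * q 0 1 - p 0 1 * q 0 0).
have Bs i j : (0 < i < 3)%N -> (0 < j < 3)%N ->
    mu * gram s i j = ADform t (f (e K i)) (f (e K j)).
  by move=> i3 j3; rewrite fB ADform_e.
split=> //.
(* Preimages of [e K 1], [e K 2] provide a left inverse of the block, as the
   image of [e K 3] has zero first and second coordinates. *)
- case: f_bij => g _ gK.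
  have ge i k : k != 2 ->
      g (e K i) 0 0 * p 0 k + g (e K i) 0 1 * q 0 k = (k.+1 == i)%:R.
    move=> k2; transitivity (f (g (e K i)) 0 k); last by rewrite gK mxE.
    rewrite {3}[g _]row3E !linearD !linearZ /= fe3 !mxE.
    by case: k k2 => [[|[|[|?]]] ?] //= _; rewrite !(mulr0, addr0).
  have := ge 1%N 0 isT; have := ge 1%N 1 isT.
  have := ge 2%N 0 isT; have := ge 2%N 1 isT.
  set x := g (e K 1); set y := g (e K 2) => /= y1 y0 x1 x0.
  apply/eqP => rho0; case/eqP: (oner_neq0 K).
  transitivity ((x 0 0 * p 0 0 + x 0 1 * q 0 0) * (y 0 0 * p 0 1 + y 0 1 * q 0 1)
              - (x 0 0 * p 0 1 + x 0 1 * q 0 1) * (y 0 0 * p 0 0 + y 0 1 * q 0 0)).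
    by rewrite x0 x1 y0 y1 mulr1 mulr0 subr0.
  transitivity ((x 0 0 * y 0 1 - x 0 1 * y 0 0)
                 * (p 0 0 * q 0 1 - p 0 1 * q 0 0)); first by ring.
  by rewrite rho0 mulr0.
- rewrite /gdet mulrBr !expr2 !mulrA.
  transitivity ((mu * gram s 1 1) * (mu * gram s 2 2)
                - (mu * gram s 1 2) * (mu * gram s 2 1)); first by ring.
  by rewrite !Bs // -/p -/q /ADform; ring.
- by rewrite /gskew mulrBr !Bs // -/p -/q /ADform; ring.
Qed.

(** AD34 is told from AD35, AD36 and AD37 by its vanishing squares; determinant
    and skew part are (0, 0), (0, 1) and (1, lambda) on these three, so
    [AD_iso_gram] separates them and gives lambda up to sign within AD37. *)
Lemma AD_iso_same_class s t : dialgebra_iso (AD s) (AD t) -> same_class s t.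
Proof.
move=> st.
have [s33 | s_neq0] := EM (s = AD33).
  have [-> | t_neq0] := EM (t = AD33); first by left.
  case: st => f [g _ gK] [fr _]; have [x [y xy1]] := ADform_neq0 t_neq0.
  case/eqP: e3_neq0; rewrite -[RHS](linear0 f) -[e K 3]scale1r -xy1 -AD_rprodE.
  by rewrite -(gK x) -(gK y) -fr s33 AD_rprodE /ADform /= !mulr0 !addr0 scale0r.
have [f [mu [[g fK gK] mu_neq0 _ fB]]] := AD_iso_form st s_neq0.
have st_square : (exists x, ADform s x x != 0) <-> (exists x, ADform t x x != 0).
  split=> -[x xx]; first by exists (f x); rewrite fB mulf_neq0.
  by exists (g x); apply: contra_neq xx => xx0; rewrite -[x]gK fB xx0 mulr0.
move: st_square; rewrite !ADform_square => st_square.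
have [nu [rho [nu_neq0 rho_neq0]]] := AD_iso_gram st s_neq0.
have t_neq0 : t <> AD33.
  move=> t33; have [x [y xy1]] := ADform_neq0 s_neq0.
  case/eqP: mu_neq0; rewrite -[mu]mulr1 -xy1 -fB t33 /ADform /=; ring.
rewrite /gdet /gskew.
case: s t s_neq0 t_neq0 st_square {st f g fK gK fB}
  => [||||a] [||||b] // _ _ [st ts] /=;
  rewrite ?(mulr0, mul0r, mulr1, subr0, sub0r, mul1r, oppr0, addr0);
  try by [left | case: st | case: ts].
- by move=> _ /esym /eqP; rewrite (negPf rho_neq0).
- by move=> /esym /eqP; rewrite expf_eq0 (negPf rho_neq0).
- by move=> _ /eqP; rewrite (negPf nu_neq0).
- by move=> /esym /eqP; rewrite expf_eq0 (negPf rho_neq0).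
- by move=> /eqP; rewrite expf_eq0 (negPf nu_neq0).
- by move=> /eqP; rewrite expf_eq0 (negPf nu_neq0).
move=> /eqP; rewrite eqf_sqr => /orP[] /eqP -> ab.
  by left; congr AD37; apply: (mulfI rho_neq0).
right; exists a; split=> //; congr AD37; apply: (mulfI rho_neq0).
by rewrite -ab mulNr mulrN.
Qed.

Lemma AD37_iso_opp (a : K) : dialgebra_iso (AD (AD37 a)) (AD (AD37 (- a))).
Proof.
apply: (@AD_iso_of_basis _ _ _ _ (e K 1) (- e K 2) (e K 3)).
- by rewrite dimvf /dim /= mul1n.
- exact: AD_dot0.
- apply/free3P => x y z /rowP xyz.
  move: (xyz 0) (xyz 1) (xyz 2).
  rewrite !mxE /= !(mulr0, mulr1, addr0, add0r, oppr0, mulrN) => -> /eqP.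
  by rewrite oppr_eq0 => /eqP -> ->.
- by move=> x; rewrite AD_rprodE -[e K 3]scale1r ADform_e3r scale0r.
- by move=> x; rewrite AD_rprodE -[e K 3]scale1r ADform_e3l scale0r.
- by rewrite AD_rprodE ADform_e.
- by rewrite linearNr AD_rprodE ADform_e //= scaleNr.
- by rewrite linearNl AD_rprodE ADform_e //= scale0r oppr0.
- by rewrite linearNl linearNr opprK AD_rprodE ADform_e.
Qed.

Lemma AD_isoP s t : dialgebra_iso (AD s) (AD t) <-> same_class s t.
Proof.
split; first exact: AD_iso_same_class.
by case=> [-> | [a [-> ->]]]; [exists idfun; first exists id | exact: AD37_iso_opp].
Qed.

End Isomorphisms.

End AntiDendriform.

Theorem theorem4p1 (R : realType) :
  [/\ forall s : AD_label R[i],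
        antidendriform (AD s) /\ associated_to (AD s) (As31 R[i]),
      forall (A : vectType R[i]) (D : dialgebra A),
        \dim {: A} = 3%N -> antidendriform D -> associated_to D (As31 R[i]) ->
        exists s : AD_label R[i], dialgebra_iso D (AD s)
    & forall s t : AD_label R[i],
        dialgebra_iso (AD s) (AD t) <-> same_class s t].
Proof.
split=> [s | A D | s t]; last exact: AD_isoP.
  by split; [exact: AD_antidendriform | exact: AD_associated_As31].
by apply: antidendriform_classification => x; exists (sqrtc x); exact: sqr_sqrtc.
Qed.
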